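(* There is an infinite family of arrangements of $n$ lines (as a system of pseudolines) such that each vertex is incident to at most $3$ lines, and no line is incident to more than $\frac{1}{2}n+O(1)$ vertices. That is, there are an absolute constant $C$ and infinitely many positive integers $n$ for each of which there exists an arrangement of $n$ lines in the plane such that every vertex of the arrangement is incident to at most $3$ of the lines and every line of the arrangement is incident to at most $\frac{1}{2}n+C$ vertices.
   Context: An (Euclidean) arrangement of pseudolines is a family of two-way infinite $x$-monotone curves in the plane $\mathbb{R}^2$ such that any two of the curves have precisely one point in common, at which they properly cross. An arrangement of $n$ lines as a system of pseudolines is such an arrangement in which all $n$ curves are straight lines (so the lines are distinct and pairwise non-parallel). A vertex of the arrangement is a point lying on at least two of the lines; vertices are counted as distinct points. *)

(* Defs.v *)
From HB Require Import structures.
From mathcomp Require Import all_boot all_order all_algebra.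
From mathcomp Require Import all_classical all_reals all_analysis.

Set Implicit Arguments.
Unset Strict Implicit.
Unset Printing Implicit Defensive.

Import Order.TTheory GRing.Theory Num.Theory.
Import numFieldNormedType.Exports.

Local Open Scope classical_set_scope.
Local Open Scope ring_scope.

(* A two-way infinite x-monotone curve is represented by the function
   f : R -> R, required to be continuous in [pseudoline_arrangement], whose
   graph it is; in particular vertical lines are not x-monotone. *)
Definition curve (R : realType) (f : R -> R) : set (R * R) :=
  [set p | p.2 = f p.1].

(* One curve is strictly below the other immediately to the left of the common
   point and strictly above it immediately to the right, or vice versa. *)
Definition properly_cross (R : realType) (f g : R -> R) (p : R * R) : Prop :=
  [/\ curve f p, curve g p &
    ((\forall x \near p.1^'-, f x < g x) /\
     (\forall x \near p.1^'+, g x < f x)) \/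
    ((\forall x \near p.1^'-, g x < f x) /\
     (\forall x \near p.1^'+, f x < g x))].

Definition pseudoline_arrangement (R : realType) (n : nat)
    (L : 'I_n -> R -> R) : Prop :=
  (forall i, continuous (L i)) /\
  (forall i j, i != j ->
     exists2 p, curve (L i) `&` curve (L j) = [set p]
              & properly_cross (L i) (L j) p).

Definition straight_line (R : realType) (A : set (R * R)) : Prop :=
  exists a b c : R,
    (a, b) != (0, 0) /\ A = [set p | a * p.1 + b * p.2 = c].

Definition line_arrangement (R : realType) (n : nat)
    (L : 'I_n -> R -> R) : Prop :=
  pseudoline_arrangement L /\ forall i, straight_line (curve (L i)).

Definition vertices (R : realType) (n : nat) (L : 'I_n -> R -> R) :
    set (R * R) :=
  [set p | exists i j : 'I_n, [/\ i != j, curve (L i) p & curve (L j) p]].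

(* Main.v *)
Require Import Defs.
From HB Require Import structures.
From mathcomp Require Import all_boot all_order all_algebra.
From mathcomp Require Import all_classical all_reals all_analysis.
From mathcomp Require Import zify ring lra.

Set Implicit Arguments.
Unset Strict Implicit.
Unset Printing Implicit Defensive.

Import Order.TTheory GRing.Theory Num.Theory.
Import numFieldNormedType.Exports.

Local Open Scope classical_set_scope.
Local Open Scope card_scope.
Local Open Scope ring_scope.

(** The lines are n tangents of a deltoid (three-cusped hypocycloid), for n
    odd: the tangent in direction [theta] is
      [y = tan theta * x + sin theta * cos theta],
    and the directions used are [theta_j = j pi / n], [0 <= j < n].

    At most three of them pass through a given point because a point (x, y) is
    on the tangent of slope t exactly when t is a root of the nonzero cubic
      [x t^3 - y t^2 + (x + 1) t - y].

    The tangents in directions a and b meet at the abscissa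
      [- cos a * cos b * cos (a + b) = - cos a * (cos (a + 2 b) + cos a) / 2],
    by [tangentB] and [cosM_cosD].  On the fixed tangent [a = theta_i] a vertex
    is therefore determined by [cos (theta_i + 2 theta_j)], that is, by
    [cos (m pi / n)] with [m = i + 2 j].  As m has the parity of i, and folding m
    into [0, n] by the symmetries of the cosine keeps its parity
    ([cos_angle_fold]), only (n + 1) / 2 values occur.  Geometrically, the
    tangents a, b and c are concurrent as soon as a + b + c is a multiple of pi,
    so that the other n - 1 lines meet a given one mostly in pairs. *)

(** * Families of lines given by slope and intercept *)

Lemma curve_affine_straight (R : realType) (s c : R) :
  straight_line (curve (fun x => s * x + c)).
Proof.
exists (- s), 1, c; split; first by rewrite xpair_eqE oner_eq0 andbF.
by apply/seteqP; split => -[x y]; rewrite /curve /= => h; lra.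
Qed.

Lemma affine_lt_cross (R : realType) (s c s' c' x0 : R) :
  s < s' -> s * x0 + c = s' * x0 + c' ->
  (\forall x \near x0^'-, s' * x + c' < s * x + c) /\
  (\forall x \near x0^'+, s * x + c < s' * x + c').
Proof.
move=> ss' e; split; near=> x.
  have xx0 : x < x0 by near: x; exact: nbhs_left_lt.
  have : 0 < (s' - s) * (x0 - x) by rewrite mulr_gt0 ?subr_gt0.
  by lra.
have xx0 : x0 < x by near: x; exact: nbhs_right_gt.
have : 0 < (s' - s) * (x - x0) by rewrite mulr_gt0 ?subr_gt0.
by lra.
Unshelve. all: by end_near. Qed.

Lemma affine_line_arrangement (R : realType) (n : nat) (s c : 'I_n -> R) :
  injective s -> line_arrangement (fun i x => s i * x + c i).
Proof.
move=> s_inj; split; last by move=> i; exact: curve_affine_straight.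
split=> [i x|i j ij].
  apply: cvgD; last exact: cvg_cst.
  by apply: cvgM; [exact: cvg_cst|exact: cvg_id].
have sij : s i - s j != 0.
  by rewrite subr_eq0; apply: contra_neq ij => /s_inj.
pose x0 := (c j - c i) / (s i - s j).
have e0 : s i * x0 + c i = s j * x0 + c j by rewrite /x0; field.
exists (x0, s i * x0 + c i).
  apply/seteqP; split => [[x y]|p -> //].
  rewrite /curve /= => -[-> e].
  have -> // : x = x0.
  by apply: (mulfI sij); rewrite /x0 mulrCA divff // mulr1; lra.
split=> //=.
have [lt_s|gt_s|eq_s] := ltgtP (s i) (s j).
- by right; exact: affine_lt_cross.
- by left; exact: affine_lt_cross.
- by rewrite eq_s subrr eqxx in sij.
Qed.

(** * Tangents of the deltoid *)

Definition deltoid_tangent (R : realType) (a x : R) : R :=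
  tan a * x + sin a * cos a.

Lemma tangentB (R : realType) (a b x : R) : cos a != 0 -> cos b != 0 ->
  deltoid_tangent a x - deltoid_tangent b x =
  sin (a - b) / (cos a * cos b) * (x + cos a * cos b * cos (a + b)).
Proof.
move=> ca cb; rewrite mulrDr (mulrA (_ / _)) divfK ?mulf_neq0 //.
have -> : sin (a - b) * cos (a + b) = sin a * cos a - sin b * cos b.
  transitivity (sin a * cos a * (cos b ^+ 2 + sin b ^+ 2)
                - sin b * cos b * (cos a ^+ 2 + sin a ^+ 2)).
    by rewrite sinB cosD; ring.
  by rewrite !cos2Dsin2 !mulr1.
rewrite sinB /deltoid_tangent /tan; field.
by rewrite ca cb.
Qed.

Lemma cosM_cosD (R : realType) (a b : R) :
  cos b * cos (a + b) = 2^-1 * (cos (a + b *+ 2) + cos a).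
Proof.
have -> : a + b *+ 2 = (a + b) + b by rewrite mulr2n addrA.
have {3}-> : a = (a + b) - b by rewrite addrK.
rewrite (cosD (a + b) b) (cosB (a + b) b); lra.
Qed.

Lemma tangent_meet_abscissa (R : realType) (a b x : R) :
  cos a != 0 -> cos b != 0 -> sin (a - b) != 0 ->
  deltoid_tangent a x = deltoid_tangent b x ->
  x = - (cos a * (2^-1 * (cos (a + b *+ 2) + cos a))).
Proof.
move=> ca cb sab /eqP; rewrite -subr_eq0 tangentB //.
rewrite !mulf_eq0 invr_eq0 mulf_eq0 (negbTE ca) (negbTE cb) (negbTE sab) /=.
by rewrite addr_eq0 => /eqP ->; rewrite -mulrA cosM_cosD.
Qed.

(** Since [sin a * cos a = t / (1 + t^2)] for [t = tan a], multiplying the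
    equation of the tangent by [1 + t^2] clears the denominator. *)
Lemma root_tangent_cubic (R : realType) (a x : R) : cos a != 0 ->
  root (Poly [:: - deltoid_tangent a x; x + 1; - deltoid_tangent a x; x])
    (tan a).
Proof.
move=> ca; rewrite /root horner_Poly /=.
have e : sin a * cos a * (1 + tan a ^+ 2) = tan a.
  by rewrite -cos2_tan2 // /tan; field.
apply/eqP; move: e; rewrite /deltoid_tangent.
set t := tan a; set u := sin a * cos a => e.
transitivity (t - u * (1 + t ^+ 2)); first by ring.
by rewrite e subrr.
Qed.

Lemma card_tangents_through (R : realType) (n : nat) (a : 'I_n -> R) (p : R * R) :
  (forall i, cos (a i) != 0) -> injective (fun i => tan (a i)) ->
  (#|[pred i : 'I_n | p \in curve (deltoid_tangent (a i))]| <= 3)%N.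
Proof.
case: p => x y ca tan_inj.
set A := [pred i | _]; pose P := Poly [:: - y; x + 1; - y; x].
(* The coefficients of degree 1 and 3 differ by 1. *)
have P0 : P != 0.
  apply/eqP => P0.
  have h1 : P`_1 = 0 by rewrite P0 coef0.
  have h3 : P`_3 = 0 by rewrite P0 coef0.
  move: h1 h3; rewrite !coef_Poly /= => h1 h3.
  by move: h1; rewrite h3 add0r => /eqP; rewrite oner_eq0.
have sP : (size P <= 4)%N := size_Poly _.
rewrite cardE -(size_map (fun i => tan (a i))) -ltnS.
apply: leq_trans sP; apply: max_poly_roots => //.
  apply/allP => _ /mapP[i iA ->].
  move: iA; rewrite mem_enum inE /curve /= => yE.
  by rewrite /P yE; exact: root_tangent_cubic.
by rewrite map_inj_uniq ?enum_uniq.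
Qed.

(** * Equally spaced directions *)

Definition angle (R : realType) (n j : nat) : R := j%:R * pi / n%:R.

Lemma angleD2 (R : realType) (n i j : nat) :
  angle R n i + angle R n j *+ 2 = angle R n (i + j.*2).
Proof. by rewrite /angle natrD -addnn natrD mulr2n; ring. Qed.

Lemma angle_ge0 (R : realType) (n j : nat) : 0 <= angle R n j.
Proof. by rewrite /angle divr_ge0 // mulr_ge0 // pi_ge0. Qed.

Lemma angle_ltpi (R : realType) (n j : nat) : (j < n)%N -> angle R n j < pi.
Proof.
move=> jn; rewrite /angle ltr_pdivrMr ?ltr0n; last exact: leq_ltn_trans jn.
by rewrite mulrC ltr_pM2l ?pi_gt0 // ltr_nat.
Qed.

Lemma cos_angle_neq0 (R : realType) (n j : nat) : odd n -> (j < n)%N ->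
  cos (angle R n j) != 0.
Proof.
move=> on jn; have n0 : n%:R != 0 :> R by rewrite pnatr_eq0; case: n on jn.
apply/eqP; rewrite -(cos_pihalf R) => /cos_inj e.
have {e} : angle R n j = pi / 2.
  have pi0 := pi_gt0 R.
  apply: e; rewrite in_itv /=; last by apply/andP; split; lra.
  by rewrite angle_ge0 ltW // angle_ltpi.
rewrite /angle => e.
(* [theta_j = pi / 2] would force [2 j = n]. *)
have : (j.*2)%:R = n%:R :> R.
  apply: (mulIf (lt0r_neq0 (pi_gt0 R))).
  have -> : (j.*2)%:R * pi = 2 * n%:R * (j%:R * pi / n%:R) :> R.
    by rewrite -muln2 natrM; field.
  by rewrite e; field.
by move/eqP; rewrite eqr_nat => /eqP jE; rewrite -jE odd_double in on.
Qed.

Lemma sin_angleB_neq0 (R : realType) (n i j : nat) :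
  (i < n)%N -> (j < n)%N -> i != j -> sin (angle R n i - angle R n j) != 0.
Proof.
wlog ij : i j / (j < i)%N => [H ilt jlt neq|ilt jlt _].
  have [lt_ij|lt_ji|e] := ltngtP i j; last by rewrite e eqxx in neq.
    by rewrite -opprB sinN oppr_eq0 H // eq_sym.
  exact: H.
have -> : angle R n i - angle R n j = angle R n (i - j).
  by rewrite /angle natrB ?(ltnW ij) //; ring.
rewrite gt_eqF // sin_gt0_pi // angle_ltpi ?(leq_ltn_trans (leq_subr _ _)) //.
rewrite andbT /angle divr_gt0 ?mulr_gt0 ?pi_gt0 ?ltr0n ?subn_gt0 //.
exact: leq_ltn_trans ilt.
Qed.

Lemma tan_angle_inj (R : realType) (n : nat) : odd n ->
  injective (fun i : 'I_n => tan (angle R n i)).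
Proof.
move=> on i j /= e; apply/val_inj/eqP/negPn/negP => neq.
have := sin_angleB_neq0 R (ltn_ord i) (ltn_ord j) neq.
have ci := cos_angle_neq0 R on (ltn_ord i).
have cj := cos_angle_neq0 R on (ltn_ord j).
have -> : sin (angle R n i - angle R n j) =
    (tan (angle R n i) - tan (angle R n j)) *
    (cos (angle R n i) * cos (angle R n j)).
  by rewrite sinB /tan; field; rewrite ci cj.
by rewrite e subrr mul0r eqxx.
Qed.

(** The reflections [m -> 2 n - m] and [m -> m - 2 n] move m by an even amount,
    hence keep its parity; this is what halves the number of values. *)
Lemma cos_angle_fold (R : realType) (n m : nat) : (0 < n)%N -> (m <= 3 * n)%N ->
  exists m', [/\ (m' <= n)%N, odd m' = odd m
                 & cos (angle R n m) = cos (angle R n m')].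
Proof.
move=> n_gt0 mn; have n0 : n%:R != 0 :> R by rewrite pnatr_eq0 -lt0n.
have [le_mn|lt_nm] := leqP m n; first by exists m.
have [le_m2n|lt_2nm] := leqP m n.*2.
  exists (n.*2 - m)%N; split; first by lia.
    by rewrite oddB // odd_double.
  rewrite -[RHS]cosN -[RHS]cosD2pi; congr cos.
  by rewrite /angle natrB // -muln2 natrM; field.
exists (m - n.*2)%N; split; first by lia.
  by rewrite oddB ?(ltnW lt_2nm) // odd_double addbF.
rewrite -[RHS]cosD2pi; congr cos.
by rewrite /angle natrB ?(ltnW lt_2nm) // -muln2 natrM; field.
Qed.

(** * Counting the vertices on a line *)

Definition deltoid_arrangement (R : realType) (n : nat) (i : 'I_n) : R -> R :=
  deltoid_tangent (angle R n i).

(** The q-th point is where the tangent i meets every tangent [j != i] such that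
    [i + 2 j] folds to [odd i + 2 q]; as [odd i + 2 q <= 2 k + 1], q is at
    most k. *)
Lemma vertices_on_tangent_sub (R : realType) (k : nat) (i : 'I_(k.*2.+1)) :
  exists f : nat -> R * R,
    vertices (@deltoid_arrangement R k.*2.+1) `&` curve (deltoid_arrangement i)
      `<=` f @` `I_k.+1.
Proof.
set n := k.*2.+1; have on : odd n by rewrite /n /= odd_double.
pose a := angle R n i.
pose X q := - (cos a * (2^-1 * (cos (angle R n (odd i + q.*2)) + cos a))).
exists (fun q => (X q, deltoid_arrangement i (X q))).
move=> p [[j1 [j2 [j12 p_j1 p_j2]]] p_i].
have {j1 j2 j12 p_j1 p_j2} [j ij p_j] : exists2 j : 'I_n, i != j
    & curve (deltoid_arrangement j) p.
  have [e|ne] := eqVneq i j1; last by exists j1.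
  by exists j2 => //; rewrite e.
have ilt := ltn_ord i; have jlt := ltn_ord j.
have px : p.1 = - (cos a * (2^-1 * (cos (angle R n (i + j.*2)) + cos a))).
  rewrite -angleD2; apply: tangent_meet_abscissa.
  - exact: cos_angle_neq0.
  - exact: cos_angle_neq0.
  - exact: sin_angleB_neq0.
  - exact: etrans (esym p_i) p_j.
have m3 : (i + j.*2 <= 3 * n)%N by lia.
have [m [mn om em]] := cos_angle_fold R (ltn0Sn k.*2) m3.
have om' : odd m = odd i by rewrite om oddD odd_double addbF.
have Xp : X m./2 = p.1 by rewrite px em /X -om' odd_double_half.
exists m./2; first by rewrite /=; move: mn; rewrite /n; lia.
by rewrite Xp; move: p_i; rewrite /curve /= => <-; case: p {p_j px Xp}.
Qed.

Theorem theorem10 (R : realType) :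
  exists C : R,
    infinite_set [set n : nat | (0 < n)%N /\
      exists L : 'I_n -> R -> R,
        [/\ line_arrangement L,
            (forall p : R * R, vertices L p ->
               (#|[pred i : 'I_n | p \in curve (L i)]| <= 3)%N)
          & (forall i : 'I_n,
               exists2 k : nat, vertices L `&` curve (L i) #= `I_k
                              & k%:R <= 2^-1 * n%:R + C)]].
Proof.
exists 2^-1; apply: (@sub_infinite_set _ ((fun k => k.*2.+1) @` setT)); last first.
  have /card_eqPle[_ le_odd] : (fun k => k.*2.+1) @` setT #= [set: nat].
    by apply: inj_card_eq => k l _ _ [] /double_inj.
  exact/infiniteP.
move=> _ [k _ <-]; split => //; exists (@deltoid_arrangement R k.*2.+1).
have on : odd k.*2.+1 by rewrite /= odd_double.
have inj := tan_angle_inj (R := R) on.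
split; first exact: affine_line_arrangement.
- move=> p _; apply: card_tangents_through => // i.
  exact: cos_angle_neq0.
- move=> i; have [f sub] := vertices_on_tangent_sub R i.
  have fin : finite_set (f @` `I_k.+1) by exact/finite_image/finite_II.
  have /finite_setP[c cE] := sub_finite_set sub fin.
  exists c => //.
  have : (c <= k.+1)%N.
    rewrite -card_le_II -(card_le_eql cE).
    exact: card_le_trans (subset_card_le sub) (card_image_le _ _).
  by rewrite -(ler_nat R) -muln2 -addn1 -[X in _ * X%:R]addn1 !natrD natrM; lra.
Qed.
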